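(* Let $(P,\le)$ be a locally finite join-semilattice with bottom element, and let $\mu_P$ be its M\''obius function. Suppose that for every $y\in P$, there exist infinitely many $z\in P$ such that (i) $z$ covers $y$; and (ii) for all $x\le y$, $\mu_P(x,z)=\mu_P(x,y)\,\mu_P(y,z)=-\mu_P(x,y)$. Then for any $f:P\to\mathbb{C}$ that is not identically zero, the support of $f$ and the support of its M\''obius transform $g:P\to\mathbb{C}$, given by $g(y)=\sum_{x\le y} f(x)$ for all $y\in P$, cannot both be finite.
   Context: An interval in a poset $(P,\le)$ is a set $[x,y]=\{z\in P: x\le z\le y\}$ with $x\le y$ in $P$. The poset is locally finite if every interval is finite. A bottom element is an element $\widehat 0\in P$ with $\widehat 0\le x$ for all $x\in P$. The join $x\vee y$ of $x,y$ is their least upper bound; $P$ is a join-semilattice if every finite set of its elements has a join in $P$. An element $z$ covers $y$ if $y<z$ and $y\le z'<z$ implies $z'=y$. The M\''obius function $\mu_P$ is the function on intervals, written $\mu_P(x,y)=\mu_P([x,y])$ for $x\le y$, defined recursively by $\mu_P(x,x)=1$ for all $x\in P$ and $\mu_P(x,y)=-\sum_{x\le z<y}\mu_P(x,z)$ for all $x<y$ in $P$. The support of $f:P\to\mathbb{C}$ is $\{x\in P: f(x)\neq 0\}$. Since $P$ is locally finite with a bottom element, the set $\{x\in P: x\le y\}$ is finite for each $y$, so the sum defining $g$ is finite. *)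

(* Defs.v *)
From mathcomp Require Import all_boot all_order all_algebra.
From mathcomp Require Import finmap.
From mathcomp Require Import classical_sets functions cardinality fsbigop.

Set Implicit Arguments.
Unset Strict Implicit.
Unset Printing Implicit Defensive.

Import Order.TTheory GRing.Theory.

Local Open Scope classical_set_scope.
Local Open Scope order_scope.

Section Poset.
Context {d : Order.disp_t} {P : porderType d}.
Implicit Types x y z : P.

Definition locally_finite : Prop :=
  forall x y, x <= y -> finite_set [set` `[x, y]].

Definition covers z y : Prop :=
  y < z /\ forall z', y <= z' -> z' < z -> z' = y.

(* The recursion defining the Möbius function, with a bound [n] on its depth. *)
Fixpoint mobius_rec (n : nat) x y : int :=
  if n isn't n'.+1 then 0%R else
  if x == y then 1%R
  else (- \sum_(z \in [set` `[x, y[]) mobius_rec n' x z)%R.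

(* The size of a finite interval bounds the recursion depth: see [mobiusE].
   Only the values [mobius x y] with [x <= y] in a locally finite poset are
   meaningful. *)
Definition mobius x y : int := mobius_rec #|` fset_set [set` `[x, y]]| x y.

Lemma mobius_rec_stable n m x y : locally_finite -> x <= y ->
  (#|` fset_set [set` `[x, y]]| <= n)%N ->
  (#|` fset_set [set` `[x, y]]| <= m)%N ->
  mobius_rec n x y = mobius_rec m x y.
Proof.
move=> lf; elim: n m y => [|n IH] [|m] y xy //.
- rewrite leqn0 cardfs_eq0 => /eqP E; have := in_fset_set (lf _ _ xy) x.
  by rewrite E inE mem_setE in_itv /= lexx xy.
- move=> _; rewrite leqn0 cardfs_eq0 => /eqP E.
  have := in_fset_set (lf _ _ xy) x.
  by rewrite E inE mem_setE in_itv /= lexx xy.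
move=> hn hm /=; case: eqP => // _; congr (- _)%R.
apply: eq_fsbigr => z; rewrite mem_setE in_itv /= => /andP[xz zy].
have lt : (#|` fset_set [set` `[x, z]]| < #|` fset_set [set` `[x, y]]|)%N.
  apply: fproper_ltn_card; rewrite fproperEneq; apply/andP; split.
    apply/eqP => /fsetP /(_ y).
    rewrite !in_fset_set; [|exact: lf..].
    by rewrite !mem_setE !in_itv /= xy lexx (lt_geF zy) andbF.
  apply/fsubsetP => t; rewrite !in_fset_set; [|exact: lf..].
  rewrite !mem_setE !in_itv /= => /andP[-> tz] /=.
  exact: le_trans tz (ltW zy).
by apply: IH => //; rewrite -ltnS; [exact: leq_trans lt hn|exact: leq_trans lt hm].
Qed.

Lemma mobiusxx x : locally_finite -> mobius x x = 1%R.
Proof.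
move=> lf; rewrite /mobius (@mobius_rec_stable _ #|` fset_set [set` `[x, x]]|.+1) //=.
by rewrite eqxx.
Qed.

Lemma mobiusE x y : locally_finite -> x < y ->
  mobius x y = (- \sum_(z \in [set` `[x, y[]) mobius x z)%R.
Proof.
move=> lf xy; have xy' := ltW xy.
rewrite {1}/mobius (@mobius_rec_stable _ #|` fset_set [set` `[x, y]]|.+1) //=.
rewrite (lt_eqF xy); congr (- _)%R.
apply: eq_fsbigr => z; rewrite mem_setE in_itv /= => /andP[xz zy].
apply: mobius_rec_stable => //; apply: fsubset_leq_card.
apply/fsubsetP => t; rewrite !in_fset_set; [|exact: lf..].
rewrite !mem_setE !in_itv /= => /andP[-> tz] /=.
exact: le_trans tz (ltW zy).
Qed.

(* For locally finite [P] with a bottom element the index set is finite;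
   over an infinite index set with infinitely many nonzero terms, the
   [fsbigop] sum is 0. *)
Definition mobius_transform {V : nmodType} (f : P -> V) : P -> V :=
  fun y => (\sum_(x \in [set x | (x <= y)%O]) f x)%R.

Definition supp {V : nmodType} (f : P -> V) : set P :=
  [set x | f x != 0%R].

End Poset.

Arguments locally_finite {d} P.

(* Main.v *)
Require Import Defs.
From mathcomp Require Import all_boot all_order all_algebra.
From mathcomp Require Import finmap.
From mathcomp Require Import classical_sets functions cardinality fsbigop reals complex.

Set Implicit Arguments.
Unset Strict Implicit.
Unset Printing Implicit Defensive.

Import Order.TTheory GRing.Theory.

Local Open Scope classical_set_scope.
Local Open Scope order_scope.

(** Suppose [f] and its transform [g] have finite support and [f y != 0].  If
    [z] covers [y], every [x <= z] with [~ x <= y] satisfies [x `|` y = z].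
    Hence all but finitely many of the [z] provided by the hypothesis at [y] lie
    outside the support of [f] and above no point of the support of [g] except
    those below [y].  For such a [z], Möbius inversion at [z] and (ii) give
    [f z = - f y], a contradiction. *)

(** Bridge to sums over sequences, where terms can be split off and double sums exchanged. *)
Lemma fsbig_seq_cond (I : choiceType) (V : nmodType) (A : set I) (s : seq I)
    (p : pred I) (F : I -> V) :
  uniq s -> (forall i, A i <-> (i \in s) && p i) ->
  (\sum_(i \in A) F i = \sum_(i <- s | p i) F i)%R.
Proof.
move=> us As; rewrite -[RHS]big_filter [RHS]fsbig_seq ?filter_uniq//.
suff -> : A = [set` filter p s] by [].
by apply/seteqP; split=> i /=; rewrite mem_filter andbC => /As.
Qed.

Lemma in_fset_itvcc (d : Order.disp_t) (P : porderType d) (x y z : P) :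
  locally_finite P -> x <= y ->
  (z \in fset_set [set` `[x, y]]) = (x <= z <= y).
Proof. by move=> lf xy; rewrite (in_fset_set (lf _ _ xy)) mem_setE in_itv. Qed.

(** For [x < y], the term at [y] cancels all the others by the recursion [mobiusE]. *)
Lemma mobius_sum (d : Order.disp_t) (P : porderType d) (x y : P) :
  locally_finite P -> x <= y ->
  (\sum_(z \in [set` `[x, y]]) mobius x z = (x == y)%:R)%R.
Proof.
move=> lf xy; have inI := in_fset_itvcc _ lf xy.
rewrite (@fsbig_seq_cond _ _ _ (fset_set [set` `[x, y]]) predT) ?fset_uniq//;
  last by move=> z; rewrite andbT inI /= in_itv.
rewrite (bigD1_seq y) ?fset_uniq ?inI ?xy ?lexx//=.
have [<-|neq] := eqVneq x y.
  rewrite mobiusxx// big1_seq ?addr0// => z /andP[zx].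
  rewrite in_fset_itvcc// => /le_anti zE.
  by rewrite zE eqxx in zx.
rewrite mobiusE ?lt_neqAle ?neq//.
rewrite (@fsbig_seq_cond _ _ _ (fset_set [set` `[x, y]]) (predC1 y))
  ?fset_uniq ?addNr// => z.
by rewrite inI /= in_itv /= (lt_neqAle z) -andbA (andbC (z <= y)).
Qed.

Section Inversion.
Context {d : Order.disp_t} {P : bPOrderType d}.
Hypothesis lfP : locally_finite P.
Implicit Types x y z : P.

Let down y : {fset P} := fset_set [set` `[\bot, y]].

Lemma mem_down x y : (x \in down y) = (x <= y).
Proof. by rewrite in_fset_itvcc ?le0x. Qed.

(** Allowing any upper bound [y] of [x] lets the inner sums of a double sum share one index
    sequence, as exchanging them requires. *)
Lemma fsbig_down (V : nmodType) (F : P -> V) x y : x <= y ->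
  (\sum_(z \in [set z | (z <= x)%O]) F z = \sum_(z <- down y | (z <= x)%O) F z)%R.
Proof.
move=> xy; apply: fsbig_seq_cond; first exact: fset_uniq.
by move=> z /=; rewrite mem_down; split=> [zx|/andP[]//]; rewrite zx (le_trans zx).
Qed.

Lemma fsbig_down_recr (V : nmodType) (F : P -> V) y :
  (\sum_(z \in [set z | (z <= y)%O]) F z = F y + \sum_(z <- down y | (z < y)%O) F z)%R.
Proof.
rewrite (@fsbig_seq_cond _ _ _ (down y) predT) ?fset_uniq//; last first.
  by move=> z; rewrite andbT mem_down.
rewrite (bigD1_seq y) ?fset_uniq ?mem_down//=; congr (_ + _)%R.
rewrite big_seq_cond [RHS]big_seq_cond; apply: eq_bigl => z.
by rewrite mem_down lt_neqAle andbCA andbb andbC.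
Qed.

(** Strong induction on the size of the lower set of [y]: the terms strictly below [y] agree, and
    cancelling them leaves the values at [y]. *)
Lemma mobius_transform_inj (V : zmodType) (f h : P -> V) :
  mobius_transform f =1 mobius_transform h -> f =1 h.
Proof.
move=> fh y; have [n] := ubnP #|` down y|; elim: n y => // n IH y len.
have := fh y; rewrite /mobius_transform !fsbig_down_recr.
have -> : (\sum_(z <- down y | (z < y)%O) f z =
           \sum_(z <- down y | (z < y)%O) h z)%R.
  apply: eq_bigr => z zy; apply: IH.
  rewrite -ltnS; apply: leq_trans len; rewrite ltnS.
  apply: fproper_ltn_card; rewrite fproperEneq; apply/andP; split.
    by apply/eqP => /fsetP/(_ y); rewrite !mem_down lexx lt_geF.
  by apply/fsubsetP => t; rewrite !mem_down => /le_trans; apply; exact: ltW.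
exact: addIr.
Qed.

Lemma mobius_inversion (V : zmodType) (f : P -> V) y :
  (f y = \sum_(x \in [set x | (x <= y)%O]) mobius_transform f x *~ mobius x y)%R.
Proof.
set g := mobius_transform f; move: y.
(* Comparing transforms only needs the left-sided recursion defining [mobius]. *)
apply: mobius_transform_inj => w; rewrite -/g [RHS](@fsbig_down _ _ w w)//.
under [RHS]eq_bigr => y yw do rewrite (@fsbig_down _ _ y w)//.
(* After the exchange, [g x] is multiplied by the sum of [mobius x y] over [x <= y <= w], which
   [mobius_sum] makes zero unless [x] is [w]. *)
rewrite (exchange_big_dep (fun x : P => x <= w)) /=; last first.
  by move=> y x yw /le_trans; apply.
have inner x : x <= w ->
    (\sum_(y <- down w | (y <= w)%O && (x <= y)%O) g x *~ mobius x y =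
     g x *~ (x == w)%:R)%R.
  move=> xw; rewrite -mulrz_sumr -mobius_sum//; congr (_ *~ _)%R.
  apply/esym/fsbig_seq_cond; first exact: fset_uniq.
  move=> y; rewrite mem_down /= in_itv /= andbA andbb.
  by rewrite andbC.
rewrite (eq_bigr _ inner) -(@fsbig_down _ _ w w)// fsbig_down_recr.
rewrite eqxx mulr1z big1 ?addr0// => x xw.
by rewrite lt_eqF// mulr0z.
Qed.

(** In the inversion sum at [z], the terms not below [y] vanish, and the sign change of [mobius]
    turns the rest into the negated inversion sum at [y]. *)
Lemma eq_opp_of_mobius_opp (V : zmodType) (f : P -> V) y z : y <= z ->
  (forall x, x <= z -> ~~ (x <= y) -> mobius_transform f x = 0%R) ->
  (forall x, x <= y -> mobius x z = (- mobius x y)%R) ->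
  (f z = - f y)%R.
Proof.
move=> yz g0 muN; rewrite (mobius_inversion f z) (mobius_inversion f y).
rewrite (@fsbig_down _ _ z z)// (@fsbig_down _ _ y z)//.
rewrite (bigID (fun x : P => x <= y)) /= [X in (_ + X)%R]big1 ?addr0; last first.
  by move=> x /andP[xz xy]; rewrite g0// mul0rz.
rewrite -sumrN; apply: eq_big => [x|x /andP[_ xy]].
  by case xy: (x <= y); rewrite ?andbF// (le_trans xy).
by rewrite muN// mulrNz.
Qed.

End Inversion.

(** The join lies between [y] and [z]. Were it strictly below [z], covering would make it equal to
    [y], forcing [x <= y]. *)
Lemma covers_join (d : Order.disp_t) (P : joinSemilatticeType d) (x y z : P) :
  covers z y -> x <= z -> ~~ (x <= y) -> x `|` y = z.
Proof.
move=> [yz cov] xz; apply: contraNeq => neq.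
have jz : x `|` y < z by rewrite lt_neqAle neq leUx xz ltW.
by rewrite -(cov _ (leUr _ _) jz) leUl.
Qed.

Theorem theorem2p1 (R : realType) (d : Order.disp_t) (P : bJoinSemilatticeType d)
    (lfP : locally_finite P)
    (hP : forall y : P, infinite_set
      [set z : P | covers z y /\
        forall x : P, x <= y ->
          mobius x z = (mobius x y * mobius y z)%R /\
          (mobius x y * mobius y z)%R = (- mobius x y)%R])
    (f : P -> R[i]) (f_neq0 : ~ (forall x : P, f x = 0%R)) :
  ~ (finite_set (supp f) /\ finite_set (supp (mobius_transform f))).
Proof.
move=> [finf fing]; apply: f_neq0 => y; apply/eqP/negPn/negP => fy.
(* By [covers_join], the image contains every cover of [y] that lies above a point of the support of
   the transform not below [y]. Points below [y] only contribute [y] itself. *)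
have bad : finite_set (supp f `|` (fun x => x `|` y) @` supp (mobius_transform f)).
  by rewrite finite_setU; split=> //; exact: finite_image.
have [z [[cov mu] nbad]] := infinite_setN0 (infinite_setD (hP y) bad).
have fz : f z = (- f y)%R.
  apply: eq_opp_of_mobius_opp => //; first exact/ltW/cov.1.
    move=> x xz xy; apply/eqP/negPn/negP => gx; apply: nbad; right.
    by exists x => //; exact: covers_join cov xz xy.
  by move=> x xy; have [-> ->] := mu x xy.
by apply: nbad; left; rewrite /supp /= fz oppr_eq0.
Qed.
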